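(* Let $q$ be a prime power and let $A$ and $B$ be parity check matrices over $\mathbb{F}_q$ of the Hamming codes $[n_a,k_a,3]_q$ and $[n_b,k_b,3]_q$, where $n_a=(q^{m_a}-1)/(q-1)\ge3$, $n_b=(q^{m_b}-1)/(q-1)\ge3$, $k_a=n_a-m_a$, $k_b=n_b-m_b$. Then $H=A\otimes B$ is a parity check matrix of a $q$-ary completely regular $[n,k,d]_q$-code $C$ with $$n=n_an_b,\quad k=n-m_am_b,\quad d=3,\quad \rho=\min\{m_a,m_b\},$$ whose intersection numbers are, for $\ell=0,1,\dots,\rho$, $$b_\ell=(q-1)\Big(n_a-\frac{q^\ell-1}{q-1}\Big)\Big(n_b-\frac{q^\ell-1}{q-1}\Big),\qquad c_\ell=\frac{q^\ell-1}{q-1}\,q^{\ell-1},\qquad a_\ell=(q-1)n_an_b-c_\ell-b_\ell .$$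
   Context: $A\otimes B$ is the Kronecker product (each entry $a_{r,s}$ of $A$ replaced by the block $a_{r,s}B$). The $q$-ary Hamming code with $m$ check symbols has a parity check matrix of size $m\times(q^m-1)/(q-1)$ whose columns are one nonzero representative of each one-dimensional subspace of $\mathbb{F}_q^m$. $\rho$ is the covering radius. For a code $C$ of length $n$ and $C(l)=\{{\bf x}\in\mathbb{F}_q^n: d({\bf x},C)=l\}$, $C$ is completely regular if for every $l\ge0$ each ${\bf x}\in C(l)$ has the same number $c_l$ of neighbors (vectors at Hamming distance 1) in $C(l-1)$ and the same number $b_l$ of neighbors in $C(l+1)$; then $a_l=(q-1)n-b_l-c_l$, and $c_0=b_\rho=0$. *)

(* Defs.v *)
From HB Require Import structures.
From mathcomp Require Import all_boot all_order all_algebra.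
Set Implicit Arguments. Unset Strict Implicit. Unset Printing Implicit Defensive.
Import Order.TTheory GRing.Theory Num.Theory.
Local Open Scope ring_scope.

Section Defs.
Variable F : finFieldType.

(* splitting an index of 'I_(m*n) into a pair (row-major / lexicographic) *)
Definition split_idx (m n : nat) (k : 'I_(m * n)) : 'I_m * 'I_n :=
  enum_val (cast_ord (esym (mxvec_cast m n)) k).

Definition kron (m1 n1 m2 n2 : nat) (A : 'M[F]_(m1, n1)) (B : 'M[F]_(m2, n2))
  : 'M[F]_(m1 * m2, n1 * n2) :=
  \matrix_(i, j) (A (split_idx i).1 (split_idx j).1 * B (split_idx i).2 (split_idx j).2).

(* A is a parity check matrix of a q-ary Hamming code: its columns are one
   nonzero representative of each one-dimensional subspace of F^m. *)
Definition is_hamming_pcm (m n : nat) (A : 'M[F]_(m, n)) : Prop :=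
  [/\ forall j : 'I_n, col j A != 0,
      forall i j : 'I_n, (exists c : F, col i A = c *: col j A) -> i = j
    & forall v : 'cV[F]_m, v != 0 -> exists (j : 'I_n) (c : F), v = c *: col j A].

Definition code (r n : nat) (H : 'M[F]_(r, n)) : {set 'rV[F]_n} :=
  [set x : 'rV[F]_n | H *m x^T == 0].

Definition wt (n : nat) (x : 'rV[F]_n) : nat := #|[set i : 'I_n | x 0 i != 0]|.
Definition hdist (n : nat) (x y : 'rV[F]_n) : nat := wt (x - y).

(* distance from x to the code C (C is assumed nonempty; the default n is an
   upper bound for all distances) *)
Definition dist_to (n : nat) (C : {set 'rV[F]_n}) (x : 'rV[F]_n) : nat :=
  \big[minn/n]_(c in C) hdist x c.

Definition min_dist_is (n : nat) (C : {set 'rV[F]_n}) (d : nat) : Prop :=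
  (exists2 x, x \in C & exists2 y, y \in C & x != y /\ hdist x y = d) /\
  (forall x y, x \in C -> y \in C -> x != y -> d <= hdist x y)%N.

Definition covering_radius (n : nat) (C : {set 'rV[F]_n}) : nat :=
  \max_(x : 'rV[F]_n) dist_to C x.

Definition nbrs_in (n : nat) (C : {set 'rV[F]_n}) (x : 'rV[F]_n) (j : nat) : nat :=
  #|[set y : 'rV[F]_n | (hdist x y == 1%N) && (dist_to C y == j)]|.

(* number of neighbours of x in C(l-1) resp. C(l+1), with l = d(x,C);
   for l = 0 there are no vectors in C(l-1), so the count is 0 *)
Definition nbrs_down (n : nat) (C : {set 'rV[F]_n}) (x : 'rV[F]_n) : nat :=
  #|[set y : 'rV[F]_n | (hdist x y == 1%N) && ((dist_to C y).+1 == dist_to C x)]|.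
Definition nbrs_up (n : nat) (C : {set 'rV[F]_n}) (x : 'rV[F]_n) : nat :=
  nbrs_in C x (dist_to C x).+1.

Definition completely_regular (n : nat) (C : {set 'rV[F]_n}) : Prop :=
  forall x y : 'rV[F]_n, dist_to C x = dist_to C y ->
    nbrs_down C x = nbrs_down C y /\ nbrs_up C x = nbrs_up C y.

End Defs.

(* Main.v *)
Require Import Defs.
From HB Require Import structures.
From mathcomp Require Import all_boot all_order all_algebra all_fingroup.
From mathcomp Require Import mxabelem zify.
Import GRing.Theory.
Local Open Scope ring_scope.

Set Implicit Arguments.
Unset Strict Implicit.
Unset Printing Implicit Defensive.

(** Arrange words as [na x nb] matrices [X]; then the syndrome for [kron A B] is
    [A *m X *m B^T], and a word of weight one has syndrome [c a_i b_j^T].  By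
    the Hamming property these syndromes are exactly the matrices of rank one,
    each occurring once, so the distance of a word to the code is the rank [l]
    of its syndrome [S], and the intersection numbers count the rank-one [E]
    for which [S + E] has rank [l + 1] or [l - 1].  Writing [E = u *m w], the
    rank goes up iff [u] and [w] lie outside the column and row space of [S];
    with [S = P *m Q] a rank factorization, it goes down iff [u = P *m t] and
    [w = s *m Q] with [s *m t = -1]. *)

(** * Hamming weight of words *)

Section HammingWeight.
Variables (F : finFieldType) (n : nat).
Implicit Types x y : 'rV[F]_n.

Lemma wt_le_size x : (wt x <= n)%N.
Proof. by rewrite -[leqRHS]card_ord max_card. Qed.

Lemma wt_eq0 x : (wt x == 0)%N = (x == 0).
Proof.
rewrite /wt cards_eq0; apply/eqP/eqP => [x0|->].
  apply/rowP => i; rewrite mxE; apply/eqP; apply: contraFT (in_set0 i).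
  by rewrite -x0 inE.
by apply/setP => i; rewrite !inE mxE eqxx.
Qed.

Lemma wt0 : wt (0 : 'rV[F]_n) = 0%N.
Proof. by apply/eqP; rewrite wt_eq0. Qed.

Lemma wtN x : wt (- x) = wt x.
Proof. by apply: eq_card => i; rewrite !inE mxE oppr_eq0. Qed.

Lemma wtD x y : (wt (x + y) <= wt x + wt y)%N.
Proof.
rewrite /wt -cardsUI; apply: leq_trans (leq_addr _ _).
apply/subset_leq_card/subsetP => i; rewrite !inE mxE.
by apply: contraR; rewrite negb_or !negbK => /andP[/eqP-> /eqP->]; rewrite addr0.
Qed.

Lemma wt_sum (I : finType) (f : I -> 'rV[F]_n) :
  (wt (\sum_i f i) <= \sum_i wt (f i))%N.
Proof.
elim/big_ind2: _ => // [|k x l y lek lel]; first by rewrite wt0.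
exact: leq_trans (wtD _ _) (leq_add lek lel).
Qed.

Lemma wt_delta (c : F) (i : 'I_n) : wt (c *: delta_mx 0 i) = (c != 0).
Proof.
have [->|c0] := eqVneq c 0; first by rewrite scale0r wt0.
rewrite /wt (_ : [set _ | _] = [set i]) ?cards1 //.
apply/setP => j; rewrite !inE !mxE eqxx /=.
by have [_|_] := eqVneq j i; rewrite ?mulr1 // mulr0 eqxx.
Qed.

Lemma wt_peel x i : x 0 i != 0 -> wt x = (wt (x - x 0 i *: delta_mx 0 i)).+1.
Proof.
move=> xi; rewrite /wt (cardsD1 i) inE xi add1n; congr _.+1.
apply: eq_card => j; rewrite !inE !mxE eqxx /=.
by have [->|_] := eqVneq j i; rewrite ?mulr1 ?subrr ?eqxx // mulr0 subr0.
Qed.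

Lemma wt_gt0 x : (0 < wt x)%N -> exists i, x 0 i != 0.
Proof. by rewrite card_gt0 => /set0Pn[i]; rewrite inE; exists i. Qed.

End HammingWeight.

(** * Rank of a matrix after adding an outer product *)

Section RankOneUpdate.
Variable F : fieldType.

Lemma mxrank_outer m n (u : 'cV[F]_m) (v : 'rV_n) : (\rank (u *m v)%R <= 1)%N.
Proof. exact: leq_trans (mxrankM_maxl _ _) (rank_leq_col _). Qed.

Lemma row_free_col_mx_row r n (Q : 'M[F]_(r, n)) (w : 'rV_n) :
  row_free Q -> ~~ (w <= Q)%MS -> row_free (col_mx Q w).
Proof.
move=> Qf wQ; rewrite /row_free eqn_leq rank_leq_row /= -addsmxE addn1.
rewrite -{1}(eqP Qf) ltn_neqAle mxrankS ?addsmxSl // andbT.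
by rewrite (mxrank_leqif_sup (addsmxSl Q w)) addsmx_sub submx_refl.
Qed.

Lemma addmx_outer m r n (P : 'M[F]_(m, r)) (Q : 'M_(r, n)) (u : 'cV_m)
    (v : 'rV_n) :
  P *m Q + u *m v = row_mx P u *m col_mx Q v.
Proof. by rewrite mul_row_col. Qed.

(** For a rank factorization [S = P *m Q] the sum is [row_mx P u *m col_mx Q w]. If [w] is outside
    the row space, the right factor is row free, so the rank is that of the left factor, which
    contains the columns of [P]. *)
Lemma mxrank_update_notin m n (S : 'M[F]_(m, n)) (u : 'cV_m) (w : 'rV_n) :
  ~~ (w <= S)%MS -> (\rank S <= \rank (S + u *m w)%R)%N.
Proof.
move=> wS; rewrite -{2}(mulmx_base S) addmx_outer mxrankMfree.
  rewrite -[X in (_ <= X)%N]mxrank_tr tr_row_mx -addsmxE.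
  apply: leq_trans (mxrankS (addsmxSl _ _)).
  by rewrite mxrank_tr (eqP (col_base_full S)).
by rewrite row_free_col_mx_row ?row_base_free // eq_row_base.
Qed.

Lemma colspaceP m n (S : 'M[F]_(m, n)) (u : 'cV_m) :
  reflect (exists t, u = col_base S *m t) (u^T <= S^T)%MS.
Proof.
have -> : (u^T <= S^T)%MS = (u^T <= (col_base S)^T)%MS.
  rewrite -{1}(mulmx_base S) trmx_mul eqmxMfull //.
  by rewrite /row_full mxrank_tr -/(row_free _) row_base_free.
apply: (iffP submxP) => [[t /(congr1 trmx)]|[t ->]].
  by rewrite trmx_mul !trmxK; exists t^T.
by exists t^T; rewrite trmx_mul.
Qed.

Lemma rowspaceP m n (S : 'M[F]_(m, n)) (w : 'rV_n) :
  reflect (exists t, w = t *m row_base S) (w <= S)%MS.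
Proof.
have <- : (w <= row_base S)%MS = (w <= S)%MS by rewrite eq_row_base.
exact: submxP.
Qed.

Lemma mxrank_update_colspace m n (S : 'M[F]_(m, n)) t (w : 'rV_n) :
  \rank (S + col_base S *m t *m w)%R = \rank (row_base S + t *m w)%R.
Proof.
transitivity (\rank (col_base S *m (row_base S + t *m w))%R).
  by rewrite mulmxDr mulmx_base mulmxA.
by rewrite (eqmxMfull _ (col_base_full S)).
Qed.

Lemma mxrank_update_rowspace m n (S : 'M[F]_(m, n)) (u : 'cV_m) t :
  \rank (S + u *m (t *m row_base S))%R = \rank (col_base S + u *m t)%R.
Proof.
rewrite -(mxrankMfree (col_base S + u *m t) (row_base_free S)).
by rewrite mulmxDl mulmx_base mulmxA.
Qed.

(** If [u = P *m t], the sum is [P *m (Q + t *m w)] and factors through dimension [\rank S]; dually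
    for [w]. Otherwise both block factors have full rank [(\rank S).+1]. *)
Lemma mxrank_update_up m n (S : 'M[F]_(m, n)) (u : 'cV_m) (w : 'rV_n) :
  (\rank (S + u *m w)%R == (\rank S).+1) = ~~ (u^T <= S^T)%MS && ~~ (w <= S)%MS.
Proof.
apply/idP/andP => [/eqP rS|[uS wS]].
  split; apply/negP.
    move=> /colspaceP[t uE]; have := rank_leq_row (row_base S + t *m w).
    by rewrite -mxrank_update_colspace -uE rS ltnn.
  move=> /rowspaceP[t wE]; have := rank_leq_col (col_base S + u *m t).
  by rewrite -mxrank_update_rowspace -wE rS ltnn.
rewrite -{1}(mulmx_base S) addmx_outer mxrankMfree.
  rewrite -mxrank_tr tr_row_mx -(addn1 (\rank S)).
  apply: row_free_col_mx_row.
    by rewrite /row_free mxrank_tr (eqP (col_base_full S)).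
  apply: contra uS => /submxP[t /(congr1 trmx)].
  by rewrite trmx_mul !trmxK => uE; apply/colspaceP; exists t^T.
by rewrite row_free_col_mx_row ?row_base_free // eq_row_base.
Qed.

(** A left kernel vector [z] is [v] scaled by [- (z *m u)]; being nonzero, it forces [v *m u = -1].
    Conversely [v] itself then lies in the left kernel. *)
Lemma mxrank_addI_outer r (u : 'cV[F]_r) (v : 'rV_r) :
  ((\rank (1%:M + u *m v)%R).+1 == r) = (v *m u == - 1%:M).
Proof.
have le_r : (r <= (\rank (1%:M + u *m v)%R).+1)%N.
  rewrite -{1}(mxrank1 F r) -{1}(addrK (u *m v) 1%:M).
  apply: leq_trans (mxrank_add _ _) _.
  by rewrite mxrank_opp -[leqRHS]addn1 leq_add2l mxrank_outer.
(* The rank is at least [r - 1], so the equality just says that the matrix is singular. *)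
have -> : ((\rank (1%:M + u *m v)%R).+1 == r) = ~~ row_free (1%:M + u *m v).
  rewrite /row_free; move: le_r (rank_leq_row (1%:M + u *m v)).
  move: (\rank _) => k; rewrite leq_eqVlt => /orP[/eqP-> _|ltr ler].
    by rewrite eqxx neq_ltn ltnSn.
  by rewrite (gtn_eqF ltr) (@eqn_leq k) ler -ltnS ltr.
apply/idP/eqP => [|vu].
  rewrite -kermx_eq0 => /rowV0Pn[z /sub_kermxP].
  rewrite mulmxDr mulmx1 mulmxA => zE z0.
  have zk : z = - (z *m u) 0 0 *: v.
    by rewrite scaleNr -mul_scalar_mx -mx11_scalar; apply/eqP; rewrite -addr_eq0 zE.
  set k := - _ in zk; have k0 : k != 0.
    by apply: contraNneq z0 => k0; rewrite zk k0 scale0r.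
  have v0 : v != 0 by apply: contraNneq z0 => v0; rewrite zk v0 scaler0.
  (* Multiply [z = k *: v] by [u]; the nonzero [k] is cancelled below. *)
  have ku : k = - (k * (v *m u) 0 0).
    by rewrite {1}/k zk -scalemxAl mxE.
  rewrite [v *m u]mx11_scalar -[in RHS]scalemx1 -[LHS]scalemx1 -scaleNr.
  congr (_ *: _).
  by apply: (mulfI k0); rewrite mulrN1 {2}ku opprK.
apply/negP => /row_free_inj inj.
have v0 : v != 0.
  apply/eqP => v0; move/matrixP/(_ 0 0)/eqP: vu.
  by rewrite v0 mul0mx !mxE eqxx eq_sym oppr_eq0 oner_eq0.
case/eqP: v0; apply: (inj); rewrite mul0mx mulmxDr mulmx1 mulmxA vu.
by rewrite mulNmx mul1mx subrr.
Qed.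

Lemma mxrank_update_core m n (S : 'M[F]_(m, n)) (t : 'cV_(\rank S)) s :
  \rank (S + col_base S *m t *m (s *m row_base S))%R = \rank (1%:M + t *m s)%R.
Proof.
rewrite mxrank_update_colspace -(mxrankMfree (1%:M + t *m s) (row_base_free S)).
by rewrite mulmxDl mul1mx mulmxA.
Qed.

(** By [mxrank_update_notin] a drop puts [w] in the row space; then [P] and [Q] cancel, which leaves
    [1%:M + t *m s], the case of [mxrank_addI_outer]. *)
Lemma mxrank_update_downP m n (S : 'M[F]_(m, n)) t (w : 'rV_n) :
  reflect (exists2 s, s *m t = - 1%:M & w = s *m row_base S)
    ((\rank (S + col_base S *m t *m w)%R).+1 == \rank S).
Proof.
apply: (iffP idP) => [rS|[s st ->]]; last first.
  by rewrite mxrank_update_core mxrank_addI_outer st.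
have /rowspaceP[s wE] : (w <= S)%MS.
  apply: contraLR rS => /(mxrank_update_notin (col_base S *m t)).
  by rewrite neq_ltn ltnS => ->; rewrite orbT.
exists s => //; apply/eqP; rewrite -mxrank_addI_outer.
by move: rS; rewrite wE mxrank_update_core.
Qed.

Lemma mxrank_update_down_colspace m n (S : 'M[F]_(m, n)) (u : 'cV_m) (w : 'rV_n) :
  (\rank (S + u *m w)%R).+1 = \rank S -> (u^T <= S^T)%MS.
Proof.
move=> rS; apply: contraPT isT => /(mxrank_update_notin w^T).
by rewrite -trmx_mul -linearD /= !mxrank_tr -rS ltnn.
Qed.

Lemma mxrank_update_bounds m n (S : 'M[F]_(m, n)) (u : 'cV_m) (w : 'rV_n) :
  (\rank S <= (\rank (S + u *m w)%R).+1)%N /\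
  (\rank (S + u *m w)%R <= (\rank S).+1)%N.
Proof.
split; last first.
  apply: leq_trans (mxrank_add _ _) _.
  by rewrite -[leqRHS]addn1 leq_add2l mxrank_outer.
rewrite -{1}(addrK (u *m w) S) (leq_trans (mxrank_add _ _)) //.
by rewrite mxrank_opp -[leqRHS]addn1 leq_add2l mxrank_outer.
Qed.

End RankOneUpdate.

(** * Counting the rows that raise or lower the rank for a fixed column *)

Section Counting.
Variable F : finFieldType.

Lemma card_rowspace m n (M : 'M[F]_(m, n)) :
  #|[set w : 'rV_n | (w <= M)%MS]| = (#|F| ^ \rank M)%N.
Proof. exact: card_rowg. Qed.

Lemma card_rowspaceC m n (M : 'M[F]_(m, n)) :
  #|[set w : 'rV_n | ~~ (w <= M)%MS]| = (#|F| ^ n - #|F| ^ \rank M)%N.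
Proof.
rewrite -card_rowspace -[n in (_ ^ n)%N]mul1n -card_mx.
rewrite -(cardsC [set w : 'rV_n | (w <= M)%MS]) addKn.
by apply: eq_card => w; rewrite !inE.
Qed.

Lemma card_rV_neq0 n : #|[set w : 'rV[F]_n | w != 0]| = (#|F| ^ n - 1)%N.
Proof.
have := card_rowspaceC (0 : 'M[F]_n); rewrite mxrank0 expn0 => <-.
by apply: eq_card => w; rewrite !inE submx0.
Qed.

(** The solutions form a coset of the left kernel of [t], which has dimension [r - 1]. *)
Lemma card_hyperplane r (t : 'cV[F]_r) (c : 'M[F]_1) : t != 0 ->
  #|[set s : 'rV_r | s *m t == c]| = (#|F| ^ (r - 1))%N.
Proof.
move=> t0; have rt : \rank t = 1%N.
  by rewrite -mxrank_tr rank_rV trmx_eq0 t0.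
have [s0 s0E] : exists s, s *m t = c.
  have /submxP[s ->] : (c <= t)%MS; last by exists s.
  apply: submx_full; by rewrite /row_full rt.
rewrite -[X in (r - X)%N]rt -mxrank_ker -card_rowspace.
rewrite -(card_imset (mem [set s | (s <= kermx t)%MS]) (addrI s0)).
apply: eq_card => s; rewrite inE; apply/eqP/imsetP => [st|[s1]].
  exists (s - s0); last by rewrite addrC subrK.
  by rewrite inE; apply/sub_kermxP; rewrite mulmxBl st s0E subrr.
by rewrite inE => /sub_kermxP s1t ->; rewrite mulmxDl s1t addr0.
Qed.

Section Updates.
Variables (m n : nat) (S : 'M[F]_(m, n)) (u : 'cV[F]_m).

Lemma card_update_up :
  #|[set w : 'rV_n | (w != 0) && (\rank (S + u *m w)%R == (\rank S).+1)]|
    = if (u^T <= S^T)%MS then 0%N else (#|F| ^ n - #|F| ^ \rank S)%N.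
Proof.
case: ifP => uS.
  by apply: eq_card0 => w; rewrite !inE mxrank_update_up uS andbF.
rewrite -card_rowspaceC; apply: eq_card => w; rewrite !inE mxrank_update_up uS /=.
by have [->|] := eqVneq w 0; rewrite ?sub0mx.
Qed.

(** With [u = P *m t], the admissible rows are [s *m Q] for [s] on the hyperplane [s *m t = -1], and
    [w] determines [s] because [Q] is row free. *)
Lemma card_update_down : u != 0 ->
  #|[set w : 'rV_n | (w != 0) && ((\rank (S + u *m w)%R).+1 == \rank S)]|
    = if (u^T <= S^T)%MS then (#|F| ^ (\rank S - 1))%N else 0%N.
Proof.
move=> u0; case: ifP => [/colspaceP[t uE]|uS]; last first.
  apply: eq_card0 => w; rewrite !inE; apply/negP => /andP[_ /eqP].
  by move/mxrank_update_down_colspace; rewrite uS.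
have t0 : t != 0 by apply: contraNneq u0 => t0; rewrite uE t0 mulmx0.
rewrite -(card_hyperplane (- 1%:M) t0).
have inj := row_free_inj (row_base_free S).
rewrite -(card_imset (mem [set s | s *m t == - 1%:M]) (inj _)).
apply: eq_card => w; rewrite inE uE; apply/andP/imsetP.
  by move=> [_ /mxrank_update_downP[s st ->]]; exists s; rewrite // inE st.
move=> [s]; rewrite inE => /eqP st wE; split; last first.
  by apply/mxrank_update_downP; exists s.
apply: contraTneq (oner_neq0 F) => w0; rewrite negbK.
have s0 : s = 0 by apply: inj; rewrite mul0mx -w0.
move/matrixP/(_ 0 0)/eqP: st.
by rewrite s0 mul0mx !mxE eqxx eq_sym oppr_eq0.
Qed.

End Updates.
End Counting.

(** * Columns of a Hamming parity check matrix as projective points *)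

Lemma outer_inj (F : fieldType) m n (u u' : 'cV[F]_m) (v v' : 'rV_n) :
  u *m v = u' *m v' -> v != 0 -> exists k, u = k *: u'.
Proof.
move=> uv /rV0Pn[j vj]; exists (v' 0 j / v 0 j); apply/colP => i; rewrite !mxE.
move/matrixP/(_ i j): uv; rewrite !mxE !big_ord1 => uv.
by rewrite mulrAC [X in X / _]mulrC -uv mulfK.
Qed.

Section HammingMatrix.
Variables (F : finFieldType) (m n : nat) (A : 'M[F]_(m, n)).
Hypothesis hA : is_hamming_pcm A.

Lemma hamming_col_neq0 i : col i A != 0.
Proof. by case: hA. Qed.

Lemma hamming_scale_inj i i' (c c' : F) : c != 0 ->
  c *: col i A = c' *: col i' A -> i = i' /\ c = c'.
Proof.
move=> c0 E; have ii' : i = i'.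
  case: hA => _ inj _; apply: inj; exists (c^-1 * c').
  by rewrite -scalerA -E scalerA mulVf // scale1r.
split=> //; move: E; rewrite -{}ii' => /eqP.
rewrite -subr_eq0 -scalerBl scaler_eq0 (negPf (hamming_col_neq0 i)) orbF subr_eq0.
by move/eqP.
Qed.

(** Equal outer products with a nonzero row have proportional columns, and distinct columns of [A]
    are never proportional; a nonzero entry of the common column then cancels. *)
Lemma hamming_outer_inj p i i' (w w' : 'rV[F]_p) : w != 0 ->
  col i A *m w = col i' A *m w' -> i = i' /\ w = w'.
Proof.
move=> w0 E; have ii' : i = i'.
  by case: hA => _ inj _; apply: inj; apply: outer_inj E w0.
split=> //; move: E; rewrite -{}ii'.
have /rV0Pn[k ak] : (col i A)^T != 0 by rewrite trmx_eq0 hamming_col_neq0.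
move=> E; apply/rowP => j; move/matrixP/(_ k j): E.
by rewrite !mxE !big_ord1; apply: mulfI; move: ak; rewrite mxE.
Qed.

(** Each nonzero vector is a nonzero multiple of a column for exactly one pair of column and
    scalar. *)
Lemma card_hamming (P : pred 'rV[F]_m) :
  #|[set w | (w != 0) && P w]|
    = #|[set t : 'I_n * F | (t.2 != 0) && P (t.2 *: (col t.1 A)^T)]|.
Proof.
rewrite -[RHS](@card_in_imset _ _ (fun t => t.2 *: (col t.1 A)^T)).
  apply: eq_card => w; rewrite inE; apply/andP/imsetP => [[w0 Pw]|[[i c]]].
    case: hA => _ _ /(_ w^T)[|i [c wE]].
      by rewrite trmx_eq0.
    have wE' : w = c *: (col i A)^T by rewrite -[w]trmxK wE linearZ.
    exists (i, c); rewrite // inE /= -wE' Pw andbT.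
    by apply: contraNneq w0 => c0; rewrite wE' c0 scale0r.
  rewrite inE /= => /andP[c0 Pw] ->; split=> //.
  by rewrite scaler_eq0 negb_or c0 trmx_eq0 hamming_col_neq0.
move=> [i c] [i' c']; rewrite !inE /= => /andP[c0 _] _ /(congr1 trmx).
by rewrite !linearZ /= !trmxK => /(hamming_scale_inj c0)[-> ->].
Qed.

(** A subspace is closed under scaling, so its nonzero vectors fall into classes of [#|F| - 1]
    multiples, one class for each column of [A] that it contains. *)
Lemma card_hamming_sub p (M : 'M[F]_(p, m)) :
  (#|[set i | ((col i A)^T <= M)%MS]| * (#|F| - 1) = #|F| ^ \rank M - 1)%N.
Proof.
have -> : (#|F| ^ \rank M - 1)%N = #|[set w : 'rV_m | (w != 0) && (w <= M)%MS]|.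
  rewrite -card_rowspace (cardsD1 0) inE sub0mx add1n subn1 /=.
  by apply: eq_card => w; rewrite !inE.
have -> : (#|F| - 1)%N = #|[set c : F | c != 0]|.
  by rewrite subn1 -(cardC1 0); apply: eq_card => c; rewrite !inE.
rewrite card_hamming -cardsX.
apply: eq_card => -[i c]; rewrite !inE /= andbC.
by have [//|c0] := eqVneq c 0; rewrite /= (eqmx_scale _ c0).
Qed.

Lemma hamming_size : (n * (#|F| - 1) = #|F| ^ m - 1)%N.
Proof.
rewrite -[X in (_ ^ X)%N](mxrank1 F m) -card_hamming_sub; congr (_ * _)%N.
by rewrite -{1}(card_ord n) -cardsT; apply: eq_card => i; rewrite !inE submx1.
Qed.

End HammingMatrix.

(** * The code of the Kronecker product: syndromes, distances, parameters *)

Section KroneckerCode.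
Variables (F : finFieldType) (ma mb na nb : nat).
Variables (A : 'M[F]_(ma, na)) (B : 'M[F]_(mb, nb)).
Implicit Types x y : 'rV[F]_(na * nb).

Let C := code (kron A B).

Definition syndrome x : 'M[F]_(ma, mb) := A *m vec_mx x *m B^T.

Lemma split_idxK m n : cancel (uncurry (@mxvec_index m n)) (@split_idx m n).
Proof. by case=> i j; rewrite /split_idx /= cast_ordK enum_rankK. Qed.

(** Row-major vectorization turns [A *m X *m B^T] into [kron A B *m x^T]; the two are compared entry
    by entry. *)
Lemma mem_code x : (x \in C) = (syndrome x == 0).
Proof.
suff E i j : (kron A B *m x^T) (mxvec_index i j) 0 = syndrome x i j.
  rewrite inE; apply/eqP/eqP => [x0|x0].
    by apply/matrixP => i j; rewrite -E x0 !mxE.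
  by apply/colP => k; case/mxvec_indexP: k => i j; rewrite E x0 !mxE.
rewrite !mxE (reindex _ (curry_mxvec_bij na nb)) /=.
transitivity (\sum_p A i p.1 * x 0 (mxvec_index p.1 p.2) * B j p.2).
  apply: eq_bigr => -[k l] _.
  by rewrite !mxE (split_idxK (i, j)) (split_idxK (k, l)) mulrAC.
rewrite -(pair_bigA _ (fun k l => A i k * x 0 (mxvec_index k l) * B j l)) /=.
rewrite exchange_big; apply: eq_bigr => l _.
by rewrite !mxE mulr_suml; apply: eq_bigr => k _; rewrite mxE.
Qed.

Fact syndrome_is_linear : linear syndrome.
Proof.
by move=> c x y; rewrite /syndrome linearP mulmxDr mulmxDl -scalemxAr -scalemxAl.
Qed.
HB.instance Definition _ :=
  GRing.isLinear.Build F 'rV[F]_(na * nb) 'M[F]_(ma, mb) _ syndrome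
    syndrome_is_linear.

Lemma syndrome_delta (c : F) i j :
  syndrome (c *: delta_mx 0 (mxvec_index i j)) = col i A *m (c *: (col j B)^T).
Proof.
rewrite linearZ /= -scalemxAr; congr (_ *: _).
rewrite /syndrome vec_mx_delta -(mul_delta_mx (0 : 'I_1)) mulmxA -colE.
by rewrite -mulmxA tr_col rowE.
Qed.

Hypotheses (hA : is_hamming_pcm A) (hB : is_hamming_pcm B).

Lemma wt1_mxvecP x : reflect
  (exists i j (c : F), c != 0 /\ x = c *: delta_mx 0 (mxvec_index i j))
  (wt x == 1%N).
Proof.
apply: (iffP eqP) => [x1|[i [j [c [c0 ->]]]]]; last by rewrite wt_delta c0.
have /wt_gt0[k xk] : (0 < wt x)%N by rewrite x1.
case/mxvec_indexP: k xk => i j xk; exists i, j, (x 0 (mxvec_index i j)); split => //.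
by move/eqP: x1; rewrite (wt_peel xk) eqSS wt_eq0 subr_eq0 => /eqP.
Qed.

(** The outer product determines [i] and the row [c *: (col j B)^T], and this row determines [j] and
    [c]. The case [y = 0] is excluded because the syndrome of [x] is nonzero. *)
Lemma syndrome_wt1_inj x y : wt x = 1%N -> (wt y <= 1)%N ->
  syndrome x = syndrome y -> x = y.
Proof.
move=> /eqP/wt1_mxvecP[i [j [c [c0 ->]]]] y1.
have cj0 : c *: (col j B)^T != 0.
  by rewrite scaler_eq0 negb_or c0 trmx_eq0 hamming_col_neq0.
rewrite syndrome_delta; case: (posnP (wt y)) => [/eqP|y_gt0].
  rewrite wt_eq0 => /eqP->; rewrite linear0 -(mulmx0 _ (col i A)) => E.
  by have [_ /eqP] := hamming_outer_inj hA cj0 E; rewrite (negPf cj0).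
have /wt1_mxvecP[i' [j' [c' [_ ->]]]] : wt y == 1%N by rewrite eqn_leq y1.
rewrite syndrome_delta => /(hamming_outer_inj hA cj0)[-> /(congr1 trmx)].
by rewrite !linearZ /= !trmxK => /(hamming_scale_inj hB c0)[-> ->].
Qed.

(** Each nonzero coordinate contributes one outer product to the syndrome; they are removed one at a
    time. *)
Lemma mxrank_syndrome x : (\rank (syndrome x) <= wt x)%N.
Proof.
have [n] := ubnP (wt x); elim: n x => // n IHn x.
case: (posnP (wt x)) => [/eqP|/wt_gt0[k xk]].
  by rewrite wt_eq0 => /eqP-> _; rewrite linear0 mxrank0.
rewrite (wt_peel xk) ltnS => /IHn; set y := x - _ => rk.
rewrite -(subrK (x 0 k *: delta_mx 0 k) x) linearD /= -[leqRHS]addn1.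
apply: leq_trans (mxrank_add _ _) (leq_add rk _).
by case/mxvec_indexP: k {xk rk y} => i j; rewrite syndrome_delta mxrank_outer.
Qed.

Lemma syndrome_outer_onto (u : 'cV[F]_ma) (v : 'rV[F]_mb) :
  exists2 x, syndrome x = u *m v & (wt x <= 1)%N.
Proof.
have [->|u0] := eqVneq u 0.
  by exists 0; rewrite ?linear0 ?mul0mx ?wt0.
have [->|v0] := eqVneq v 0.
  by exists 0; rewrite ?linear0 ?mulmx0 ?wt0.
case: hA => _ _ /(_ u u0)[i [c ->]].
case: hB => _ _ /(_ v^T); rewrite trmx_eq0 => /(_ v0)[j [d /(congr1 trmx)]].
rewrite trmxK linearZ /= => ->; exists ((c * d) *: delta_mx 0 (mxvec_index i j)).
  by rewrite syndrome_delta -scalerA -scalemxAr -scalemxAl.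
by rewrite wt_delta leq_b1.
Qed.

(** [S] is a sum of [\rank S] outer products, each of which is the syndrome of a word of weight at
    most one. *)
Lemma syndrome_onto (S : 'M[F]_(ma, mb)) :
  exists2 x, syndrome x = S & (wt x <= \rank S)%N.
Proof.
have /fin_all_exists2[f fE f1] : forall k, exists2 x,
    syndrome x = col k (col_base S) *m row k (row_base S) & (wt x <= 1)%N.
  by move=> k; apply: syndrome_outer_onto.
exists (\sum_k f k).
  rewrite linear_sum /= -[RHS]mulmx_base; apply/matrixP => i j.
  by rewrite summxE mxE; apply: eq_bigr => k _; rewrite fE !mxE big_ord1 !mxE.
apply: leq_trans (wt_sum _) _; rewrite -[leqRHS]card_ord -sum1_card.
exact: leq_sum.
Qed.

(** Subtracting a codeword keeps the syndrome, so the remaining weight is at least the rank. A light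
    word [y] with the syndrome of [x] attains this, at the codeword [x - y]. *)
Lemma dist_toE x : dist_to C x = \rank (syndrome x).
Proof.
have ge_rk : (\rank (syndrome x) <= dist_to C x)%N.
  rewrite /dist_to; elim/big_rec: _ => [|c m cC le_m].
    (* The default value [na * nb] of the minimum also bounds the rank, through the weight of
       [x]. *)
    exact: leq_trans (mxrank_syndrome x) (wt_le_size x).
  rewrite leq_min le_m andbT; apply: leq_trans (mxrank_syndrome _).
  by move: cC; rewrite mem_code linearB /= => /eqP->; rewrite subr0.
apply/eqP; rewrite eqn_leq ge_rk andbT.
have [y yE le_y] := syndrome_onto (syndrome x).
have yC : x - y \in C by rewrite mem_code linearB /= yE subrr.
rewrite /dist_to -Order.NatOrder.minEnat -leEnat.
apply: Order.TotalTheory.bigmin_inf yC _.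
by rewrite leEnat /hdist opprB addrC subrK.
Qed.

(** Changing [x] by [c] at position [(i, j)] adds [col i A *m (c *: (col j B)^T)] to the syndrome;
    for fixed [i] the right factor runs once through all nonzero rows. *)
Lemma card_neighbours x (P : pred 'M[F]_(ma, mb)) :
  #|[set y | (hdist x y == 1%N) && P (syndrome y)]|
    = (\sum_i #|[set w : 'rV_mb | (w != 0%R) && P (syndrome x + col i A *m w)%R]|)%N.
Proof.
under [RHS]eq_bigr => i _ do rewrite (card_hamming hB).
pose e (t : 'I_na * ('I_nb * F)) : 'rV[F]_(na * nb) :=
  t.2.2 *: delta_mx 0 (mxvec_index t.1 t.2.1).
pose D := [set t : 'I_na * ('I_nb * F) | (t.2.2 != 0) && P (syndrome (x + e t))].
transitivity #|D|; last first.
  rewrite /D -sum1dep_card.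
  pose Q i t := (t.2 != 0) && P (syndrome (x + e (i, t))).
  rewrite -(pair_big_dep predT Q (fun _ _ => 1%N)) /=.
  apply: eq_bigr => i _; rewrite sum1dep_card; apply: eq_card => -[j c].
  by rewrite !inE /Q linearD /= syndrome_delta.
rewrite -(@card_in_imset _ _ (fun t => x + e t)).
  apply: eq_card => y; rewrite inE; apply/andP/imsetP => [[]|[[i [j c]]]].
    rewrite /hdist -wtN opprB => /wt1_mxvecP[i [j [c [c0 yE]]]] Py.
    have yE' : y = x + e (i, (j, c)) by rewrite /e /= -yE addrC subrK.
    by exists (i, (j, c)); rewrite // inE /= c0 -yE'.
  rewrite inE /= => /andP[c0 Px] ->; split => //.
  by rewrite /hdist opprD addrA subrr sub0r wtN /e wt_delta c0.
move=> [i [j c]] [i' [j' c']]; rewrite !inE /= => /andP[c0 _] _ /addrI.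
move/(congr1 syndrome); rewrite !syndrome_delta /=.
have cj0 : c *: (col j B)^T != 0.
  by rewrite scaler_eq0 negb_or c0 trmx_eq0 hamming_col_neq0.
move=> /(hamming_outer_inj hA cj0)[-> /(congr1 trmx)].
by rewrite !linearZ /= !trmxK => /(hamming_scale_inj hB c0)[-> ->].
Qed.

(** If [x] has weight at most two and [e] is one of its nonzero entries, then [e] and [e - x] have
    weight at most one and equal syndromes, hence coincide. *)
Lemma code_wt_gt2 x : x \in C -> x != 0 -> (3 <= wt x)%N.
Proof.
rewrite mem_code => /eqP sx x0; rewrite ltnNge; apply/negP => x2.
have /wt_gt0[k xk] : (0 < wt x)%N by rewrite lt0n wt_eq0.
pose e : 'rV_(na * nb) := x 0 k *: delta_mx 0 k.
have e1 : wt e = 1%N by rewrite wt_delta xk.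
have le1 : (wt (e - x) <= 1)%N.
  by move: x2; rewrite (wt_peel xk) ltnS -(wtN (e - x)) opprB.
have E : syndrome e = syndrome (e - x) by rewrite linearB /= sx subr0.
by case/eqP: x0; rewrite -[x](subKr e) -(syndrome_wt1_inj e1 le1 E) subrr.
Qed.

(** The sum of two columns of [A] is a multiple of some column; this relation, placed in one column
    [j] of the array, is a codeword. *)
Lemma code_wt3 : (1 < na)%N -> (0 < nb)%N -> exists2 x, x \in C & wt x = 3%N.
Proof.
move=> na1 nb0; pose i0 := Ordinal (ltnW na1); pose i1 := Ordinal na1.
pose j := Ordinal nb0.
have nz : col i0 A + col i1 A != 0.
  rewrite addrC addr_eq0; apply/eqP => E.
  have /(congr1 val) // : i1 = i0.
  by case: hA => _ inj _; apply: inj; exists (-1); rewrite scaleN1r.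
case: (hA) => _ _ /(_ _ nz)[i [c E]].
pose d k : 'rV[F]_(na * nb) := delta_mx 0 (mxvec_index k j).
pose x := d i0 + d i1 - c *: d i.
have d1 k : wt (d k) = 1%N by rewrite -[d k]scale1r wt_delta oner_neq0.
have sd k : syndrome (d k) = col k A *m (col j B)^T.
  by rewrite -[d k]scale1r syndrome_delta scale1r.
have xC : x \in C.
  rewrite mem_code linearB linearD linearZ /= !sd.
  by rewrite scalemxAl -mulmxDl -mulmxBl E subrr mul0mx.
have inj k k' : mxvec_index k j = mxvec_index k' j -> k = k'.
  move/(congr1 (@split_idx _ _)).
  by rewrite (split_idxK (k, j)) (split_idxK (k', j)) => -[].
exists x => //; apply/eqP; rewrite eqn_leq; apply/andP; split.
  apply: leq_trans (wtD _ _) _; rewrite -[3%N]/(2 + 1)%N leq_add //.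
    by apply: leq_trans (wtD _ _) _; rewrite !d1.
  by rewrite wtN wt_delta leq_b1.
(* For [x != 0]: the entry at [(i0, j)] is 1 unless [i = i0], and then [col i1 A] would be [c - 1]
   times [col i0 A]. *)
apply: code_wt_gt2 => //; apply/eqP => /rowP/(_ (mxvec_index i0 j)).
rewrite !mxE !eqxx /= (negPf (_ : mxvec_index i0 j != mxvec_index i1 j)); last first.
  by apply/eqP => /inj.
have [/inj ii|_] := eqVneq (mxvec_index i0 j) (mxvec_index i j); last first.
  by rewrite mulr0 subr0 addr0 => /eqP; rewrite oner_eq0.
have /(congr1 val) // : i1 = i0.
case: hA => _ + _; apply; exists (c - 1).
by rewrite scalerBl scale1r ii -E -ii addrC addKr.
Qed.

(** The syndrome map is onto and its fibres are cosets of [C]. *)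
Lemma card_code : #|C| = (#|F| ^ (na * nb - ma * mb))%N.
Proof.
have q0 : (0 < #|F|)%N by apply/card_gt0P; exists 0.
have E : (#|F| ^ (na * nb) = #|F| ^ (ma * mb) * #|C|)%N.
  rewrite -[(na * nb)%N in LHS]mul1n -!card_mx -[LHS]sum1_card.
  rewrite (partition_big syndrome predT) //=.
  rewrite -sum_nat_const; apply: eq_bigr => S _.
  have [x0 x0S _] := syndrome_onto S.
  rewrite sum1dep_card -(card_imset (mem C) (addrI x0)); apply: eq_card => x.
  rewrite inE; apply/eqP/imsetP => [xS|[y]].
    by exists (x - x0); rewrite ?mem_code ?linearB /= ?xS ?x0S ?subrr // addrC subrK.
  by rewrite mem_code => /eqP y0 ->; rewrite linearD /= x0S y0 addr0.
(* The subtraction in the exponent is truncated; the bound follows from the count, as [C] contains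
   0. *)
have le_mn : (ma * mb <= na * nb)%N.
  rewrite -(leq_exp2l _ _ (card_finNzRing_gt1 F)) E.
  by rewrite leq_pmulr //; apply/card_gt0P; exists 0; rewrite mem_code linear0.
apply/eqP; rewrite -(eqn_pmul2l (_ : 0 < #|F| ^ (ma * mb))%N) ?expn_gt0 ?q0 //.
by rewrite -E -expnD subnKC.
Qed.

Lemma covering_radiusE : covering_radius C = minn ma mb.
Proof.
apply/eqP; rewrite eqn_leq; apply/andP; split.
  apply/bigmax_leqP => x _; rewrite dist_toE leq_min.
  by rewrite rank_leq_row rank_leq_col.
have [x xE _] := syndrome_onto (pid_mx (minn ma mb)).
rewrite /covering_radius (bigmax_sup x) // dist_toE xE.
by rewrite rank_pid_mx ?geq_minl ?geq_minr.
Qed.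

(** * Intersection numbers *)

Section IntersectionNumbers.
Variable x : 'rV[F]_(na * nb).
Let q := #|F|.
Let l := dist_to C x.
(** The number of one-dimensional subspaces of an [l]-dimensional space; [cardK] finds as many
    columns of [A] in the column space of the syndrome. *)
Let K := ((q ^ l - 1) %/ (q - 1))%N.

Let q1 : (0 < q - 1)%N.
Proof. by rewrite subn_gt0 card_finNzRing_gt1. Qed.

Let cardK : #|[set i | ((col i A)^T <= (syndrome x)^T)%MS]| = K.
Proof.
rewrite /K /l dist_toE -mxrank_tr -(card_hamming_sub hA) mulnK //.
Qed.

(** Each of the [na - K] columns of [A] outside the column space admits [q ^ mb - q ^ l] rows, which
    is [(q - 1) * (nb - K)]. *)
Lemma nbrs_upE : nbrs_up C x = ((q - 1) * (na - K) * (nb - K))%N.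
Proof.
rewrite /nbrs_up /nbrs_in.
rewrite (_ : [set _ | _] = [set y | (hdist x y == 1%N) &&
  (\rank (syndrome y) == (\rank (syndrome x)).+1)]); last first.
  by apply/setP => y; rewrite !inE !dist_toE.
rewrite (card_neighbours x (fun S => \rank S == (\rank (syndrome x)).+1)).
under eq_bigr => i _ do rewrite card_update_up.
rewrite (eq_bigr (fun i => if ~~ ((col i A)^T <= (syndrome x)^T)%MS
  then (q ^ mb - q ^ l)%N else 0%N)); last first.
  by move=> i _; rewrite -dist_toE if_neg.
rewrite -big_mkcond /= sum_nat_const -cardsE.
have -> : #|[set i | ~~ ((col i A)^T <= (syndrome x)^T)%MS]| = (na - K)%N.
  rewrite cardsCs card_ord -cardK; congr (_ - _)%N.
  by apply: eq_card => i; rewrite !inE negbK.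
have KE : (K * (q - 1) = q ^ l - 1)%N.
  by rewrite -cardK (card_hamming_sub hA) mxrank_tr -dist_toE.
rewrite [RHS]mulnAC [LHS]mulnC; congr (_ * _)%N.
have q_gt0 k : (0 < q ^ k)%N by rewrite expn_gt0 ltnW ?card_finNzRing_gt1.
by rewrite [RHS]mulnC mulnBl (hamming_size hB) KE subnBA // subnK.
Qed.

(** Each of the [K] columns inside the column space admits [q ^ (l - 1)] rows. For [l = 0] the
    truncated exponent is harmless because [K = 0]. *)
Lemma nbrs_downE : nbrs_down C x = (K * q ^ (l - 1))%N.
Proof.
rewrite /nbrs_down.
rewrite (_ : [set _ | _] = [set y | (hdist x y == 1%N) &&
  ((\rank (syndrome y)).+1 == \rank (syndrome x))]); last first.
  by apply/setP => y; rewrite !inE !dist_toE.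
rewrite (card_neighbours x (fun S => (\rank S).+1 == \rank (syndrome x))).
under eq_bigr => i _ do rewrite card_update_down ?hamming_col_neq0 // -dist_toE.
by rewrite -big_mkcond sum_nat_const -cardsE cardK.
Qed.

Lemma card_sphere1 : #|[set y | hdist x y == 1%N]| = ((q - 1) * (na * nb))%N.
Proof.
rewrite (_ : [set _ | _]
  = [set y | (hdist x y == 1%N) && predT (syndrome y)]); last first.
  by apply/setP => y; rewrite !inE andbT.
rewrite card_neighbours /=.
rewrite (eq_bigr (fun=> (#|F| ^ mb - 1)%N)); last first.
  by move=> i _; rewrite -card_rV_neq0; apply: eq_card => w; rewrite !inE andbT.
by rewrite sum_nat_const card_ord -(hamming_size hB) mulnA mulnC.
Qed.

Lemma dist_to_neighbour y : hdist x y = 1%N ->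
  (l <= (dist_to C y).+1)%N /\ (dist_to C y <= l.+1)%N.
Proof.
rewrite /hdist -wtN opprB => /eqP/wt1_mxvecP[i [j [c [_ yE]]]].
rewrite /l !dist_toE -[y](subrK x) yE addrC linearD /= syndrome_delta.
exact: mxrank_update_bounds.
Qed.

(** A neighbour changes the rank by at most one, so exactly one of the three indicators is 1. *)
Lemma nbrs_sum :
  (nbrs_down C x + nbrs_in C x l + nbrs_up C x = (q - 1) * (na * nb))%N.
Proof.
rewrite -card_sphere1 /nbrs_down /nbrs_up /nbrs_in -/l.
rewrite -!sum1dep_card [X in (X + _ + _)%N]big_mkcond [X in (_ + X + _)%N]big_mkcond.
rewrite [X in (_ + _ + X)%N]big_mkcond [RHS]big_mkcond -!big_split /=.
apply: eq_bigr => y _; case: eqP => //= /dist_to_neighbour[].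
case: eqP => h1; case: eqP => h2; case: eqP => h3 //=; lia.
Qed.


End IntersectionNumbers.
End KroneckerCode.

Theorem theorem4p1 (F : finFieldType) (q ma mb na nb : nat)
    (A : 'M[F]_(ma, na)) (B : 'M[F]_(mb, nb)) :
  #|F| = q ->
  na = ((q ^ ma - 1) %/ (q - 1))%N -> nb = ((q ^ mb - 1) %/ (q - 1))%N ->
  (3 <= na)%N -> (3 <= nb)%N ->
  is_hamming_pcm A -> is_hamming_pcm B ->
  let C := code (kron A B) in
  let n := (na * nb)%N in
  let rho := minn ma mb in
  [/\ #|C| = (q ^ (n - ma * mb))%N,
      min_dist_is C 3,
      covering_radius C = rho,
      completely_regular C
    & forall (l : nat) (x : 'rV[F]_(na * nb)), (l <= rho)%N -> dist_to C x = l ->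
        let bl := ((q - 1) * (na - (q ^ l - 1) %/ (q - 1)) * (nb - (q ^ l - 1) %/ (q - 1)))%N in
        let cl := ((q ^ l - 1) %/ (q - 1) * q ^ (l - 1))%N in
        [/\ nbrs_up C x = bl, nbrs_down C x = cl
          & nbrs_in C x l = ((q - 1) * n - cl - bl)%N]].
Proof.
move=> <- _ _ na3 nb3 hA hB C n rho; split.
- exact: card_code.
- split.
    have [x xC x3] := code_wt3 hA hB (ltnW na3) (ltnW (ltnW nb3)).
    exists x => //; exists 0; first by rewrite mem_code linear0.
    by rewrite /hdist subr0 -wt_eq0 x3.
  move=> x y xC yC xy; apply: (code_wt_gt2 hA hB); last by rewrite subr_eq0.
  move: xC yC; rewrite !mem_code linearB /= => /eqP-> /eqP->.
  by rewrite subrr.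
- exact: covering_radiusE.
- by move=> x y xy; rewrite !(nbrs_downE hA hB) !(nbrs_upE hA hB) xy.
move=> l x _ xl bl cl.
have up : nbrs_up C x = bl by rewrite (nbrs_upE hA hB) xl.
have down : nbrs_down C x = cl by rewrite (nbrs_downE hA hB) xl.
(* Writing [(q - 1) * n] as the sum of the three neighbour counts makes the truncated subtractions
   exact. *)
split=> //; rewrite -up -down /n -(nbrs_sum hA hB x) xl.
by rewrite -addnA addKn addnK.
Qed.
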